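(* Let $K \subseteq \mathbb{R}^2$ be a symmetric convex body with $d_{BM}(K,\mathbb{B}^2) \geq \sqrt{2} - \varepsilon$ for some $\varepsilon > 0$. Then $$ d_{BM}(K,\mathcal{P}^2) < 1 + c\, \varepsilon, $$ where $c = 5 \sqrt{2}$.
   Context: A convex body in $\mathbb{R}^n$ is a compact convex set with non-empty interior; it is symmetric if it has a center of symmetry, i.e. some translate of it is invariant under $x\mapsto -x$. $\mathbb{B}^2$ is the closed Euclidean unit disc in $\mathbb{R}^2$ and $\mathcal{P}^2=[-1,1]^2$. The Banach-Mazur distance of convex bodies $K,L\subseteq\mathbb{R}^n$ is $d_{BM}(K,L)=\inf\{\rho>0 : K+u\subseteq T(L+v)\subseteq\rho(K+u)\}$, where the infimum is over all invertible linear operators $T:\mathbb{R}^n\to\mathbb{R}^n$ and vectors $u,v\in\mathbb{R}^n$ (it is attained, and for origin symmetric $K,L$ one may take $u=v=0$). *)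

(* Defs.v *)
From HB Require Import structures.
From mathcomp Require Export all_boot all_order all_algebra.
From mathcomp Require Export all_classical all_reals all_analysis.

Set Implicit Arguments.
Unset Strict Implicit.
Unset Printing Implicit Defensive.

Import Order.TTheory GRing.Theory Num.Theory.
Import numFieldNormedType.Exports.

Local Open Scope classical_set_scope.
Local Open Scope ring_scope.

(* R^n is 'rV[R]_n with its product topology. The library's norm on it is the
   sup norm, so the Euclidean norm is defined separately. *)
Section ConvexBodies.
Context {R : realType} {n : nat}.
Implicit Types (K L A : set 'rV[R]_n) (u v : 'rV[R]_n).

Definition translate A u : set 'rV[R]_n := [set x + u | x in A].

Definition dilate (rho : R) A : set 'rV[R]_n := [set rho *: x | x in A].

Definition convex_body K : Prop :=
  [/\ compact K, convex_set (K : set (convex_lmodType 'rV[R]_n)) & K° !=set0].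

Definition symmetric_body K : Prop :=
  exists u, [set - x | x in translate K u] = translate K u.

Definition enorm u : R := Num.sqrt (\sum_(i < n) u ord0 i ^+ 2).

Definition bm_position K L (rho : R) : Prop :=
  exists (T : {linear 'rV[R]_n -> 'rV[R]_n}) u v,
    [/\ bijective T,
        translate K u `<=` [set T x | x in translate L v] &
        [set T x | x in translate L v] `<=` dilate rho (translate K u)].

(* The infimum is taken in R, where inf set0 = 0; for convex bodies the set
   below is non-empty and bounded below by 0, so this is the true infimum. *)
Definition d_BM K L : R := inf [set rho : R | 0 < rho /\ bm_position K L rho].

End ConvexBodies.

Definition euclidean_ball (R : realType) (n : nat) : set 'rV[R]_n :=
  [set x | enorm x <= 1].

Definition cube (R : realType) (n : nat) : set 'rV[R]_n :=
  [set x | forall i : 'I_n, x ord0 i \in `[-1, 1]].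

(* Main.v *)
Require Import Defs.
From mathcomp Require Import ring lra.
Import Order.TTheory GRing.Theory Num.Theory.
Import numFieldNormedType.Exports.
Local Open Scope classical_set_scope.
Local Open Scope ring_scope.

(** Centre [K] at the origin and inscribe in it a parallelogram of maximal area.
    Use linear coordinates [(X, Y)] in which this parallelogram is the square
    [[-1, 1]^2]. By maximality, the line through a vertex parallel to the
    diagonal that avoids this vertex supports [K]; that is, [|X| + |Y| <= 2] on
    [K]. Let [1 + s] and [1 + r] be the maxima of [X] and of [Y] on [K], attained
    at [p = (1 + s, t)] and [q = (t', 1 + r)], where necessarily [|t| <= 1 - s]
    and [|t'| <= 1 - r]. The inscribed parallelogram with vertices [+-p], [+-q]
    is not larger than the square either, whence [m := s + r <= 1]
    ([exists_adapted]).

    Both distances are now controlled by [m].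

    For the square: [K] contains [[-1, 1]^2] and lies in the rectangle
    [[-1-s, 1+s] x [-1-r, 1+r]], so [d_BM K cube <= 1 + m] ([d_BM_cube_le]).

    For the disc: with [N = 2 - m + s r], the ellipse with semi-axes [A, B],
    [A^2 = (2 + s - r) / N] and [B^2 = (2 + r - s) / N], is inside the convex
    hull of the square, [+-p] and [+-q] for all admissible [t, t']
    ([ellipse_sub]); for [t = 1 - s] and [t' = 1 - r] it touches the edges from
    [p] to [(1, -1)] and from [q] to [(-1, 1)]. Its smallest homothet containing
    the octagon [|X| <= 1 + s, |Y| <= 1 + r, |X| + |Y| <= 2], and hence [K],
    passes through all the vertices of the octagon ([octagon_ellipse]), and the
    square of the homothety ratio is
    [4 N (1 + s r) / ((2 + s - r) (2 + r - s)) <= 2 (1 - m / 5)]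
    ([ratio_bound]). Hence [d_BM K ball <= sqrt (2 (1 - m / 5))]
    ([d_BM_ball_le]).

    The last bound is at most [sqrt 2 (1 - m / 10)], strictly less when [m > 0].
    So [sqrt 2 - eps <= d_BM K ball] forces [m < 5 sqrt 2 eps], and the bound
    for the square concludes. *)

(** * An ellipse between a spiked square and an octagon *)

(** Planar convex sets are handled as relations between coordinates: the
    exchange of the two axes is then just the exchange of the arguments. *)
Definition convex_rel {R : realType} (C : R -> R -> Prop) : Prop :=
  forall k x y x' y', 0 <= k <= 1 -> C x y -> C x' y' ->
    C (k * x + (1 - k) * x') (k * y + (1 - k) * y').

Lemma convex_rel_conv3 {R : realType} {C : R -> R -> Prop}
    {i j k x1 y1 x2 y2 x3 y3 : R} :
  convex_rel C -> 0 <= i -> 0 <= j -> 0 <= k -> i + j + k = 1 ->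
  C x1 y1 -> C x2 y2 -> C x3 y3 ->
  C (i * x1 + j * x2 + k * x3) (i * y1 + j * y2 + k * y3).
Proof.
move=> Cconv i0 j0 k0 ijk C1 C2 C3.
have [ij0|ij0] := eqVneq (i + j) 0.
  have [-> -> ->] : [/\ i = 0, j = 0 & k = 1] by split; lra.
  by rewrite !mul0r !add0r !mul1r.
have ij_gt0 : 0 < i + j by rewrite lt_def ij0; lra.
have q01 : 0 <= i / (i + j) <= 1.
  by rewrite divr_ge0 ?ler_pdivrMr //=; lra.
have := Cconv (i + j) _ _ _ _ _ (Cconv (i / (i + j)) _ _ _ _ q01 C1 C2) C3.
have split12 a b : (i + j) * (i / (i + j) * a + (1 - i / (i + j)) * b) =
    i * a + j * b by field.
rewrite !split12.
have -> : 1 - (i + j) = k by lra.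
by apply; lra.
Qed.

Lemma square_sub {R : realType} {C : R -> R -> Prop} {x y : R} :
  convex_rel C -> (forall x y, C x y -> C (- x) (- y)) ->
  C 1 1 -> C 1 (-1) -> -1 <= x <= 1 -> -1 <= y <= 1 -> C x y.
Proof.
move=> Cconv Csym Cpp Cpm hx hy.
have Cmp : C (-1) 1 by have := Csym _ _ Cpm; rewrite opprK.
have edge s : -1 <= s <= 1 -> C 1 s.
  move=> hs; have := Cconv ((1 + s) / 2) _ _ _ _ _ Cpp Cpm.
  have -> : (1 + s) / 2 * 1 + (1 - (1 + s) / 2) * 1 = 1 by field.
  have -> : (1 + s) / 2 * 1 + (1 - (1 + s) / 2) * -1 = s by field.
  by apply; lra.
have edge' : C (-1) y.
  by have := Csym _ _ (edge (- y) _); rewrite opprK; apply; lra.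
have := Cconv ((1 + x) / 2) _ _ _ _ _ (edge y hy) edge'.
have -> : (1 + x) / 2 * 1 + (1 - (1 + x) / 2) * -1 = x by field.
have -> : (1 + x) / 2 * y + (1 - (1 + x) / 2) * y = y by field.
by apply; lra.
Qed.

(** The support function of the unit disc is the Euclidean norm. *)
Lemma disc_support_le {R : realType} {a b x y c : R} :
  x ^+ 2 + y ^+ 2 <= 1 -> 0 <= c -> a ^+ 2 + b ^+ 2 <= c ^+ 2 ->
  a * x + b * y <= c.
Proof.
move=> xy1 c0 abc; apply: (le_trans (ler_norm _)).
rewrite -ler_sqr ?nnegrE ?normr_ge0 // real_normK ?num_real //.
have [p0 q0] : 0 <= a ^+ 2 + b ^+ 2 /\ 0 <= (a * y - b * x) ^+ 2.
  by split; rewrite ?addr_ge0 ?sqr_ge0.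
nra.
Qed.

(** The part of the ellipse beyond the side [X = 1] of the square lies in the
    triangle with vertices [(1, 1)], [(1, -1)] and [p = (1 + s, t)]. By
    Cauchy-Schwarz the ellipse does not cross the two sides of this triangle
    that meet at [p]; the barycentric coordinates are then nonnegative. *)
Lemma ellipse_cap_sub {R : realType} {C : R -> R -> Prop}
    {s r t A B x y : R} (N := 2 - (s + r) + s * r) :
  convex_rel C -> C 1 1 -> C 1 (-1) -> C (1 + s) t -> `|t| <= 1 - s ->
  0 <= s -> 0 <= r -> s + r <= 1 ->
  A ^+ 2 * N = 2 + s - r -> B ^+ 2 * N = 2 + r - s ->
  x ^+ 2 + y ^+ 2 <= 1 -> 1 < A * x -> C (A * x) (B * y).
Proof.
move=> Cconv Cpp Cpm Cp ht s0 r0 sr A2 B2 xy1 Ax1.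
have {ht} ht : s - 1 <= t <= 1 - s by move: ht; rewrite ler_norml; lra.
have P0 : 0 <= s * r by nra.
have N1 : 1 <= N by rewrite /N; lra.
have N0 : 0 < N by lra.
(* [u X + w Y = u + s] is the line through [p] and [(1, -1)] for [u = 1 + t],
   [w = - s], and the line through [p] and [(1, 1)] for [u = 1 - t], [w = s]. *)
have cut u w : s <= u <= 2 - s -> w ^+ 2 = s ^+ 2 ->
    u * (A * x) + w * (B * y) <= u + s.
  move=> hu w2; rewrite !mulrA; apply: disc_support_le => //; first lra.
  rewrite !exprMn w2 -(ler_pM2r N0) -subr_ge0.
  have -> : (u + s) ^+ 2 * N - (u ^+ 2 * A ^+ 2 + s ^+ 2 * B ^+ 2) * N =
      (u + s) ^+ 2 * N - (u ^+ 2 * (A ^+ 2 * N) + s ^+ 2 * (B ^+ 2 * N)).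
    by ring.
  rewrite A2 B2.
  (* The bound is an equality at [u = 2 - s]: this dictates the choice of the
     semi-axes. *)
  have -> : (u + s) ^+ 2 * N - (u ^+ 2 * (2 + s - r) + s ^+ 2 * (2 + r - s))
     = s * ((2 - s - u) * ((2 - r) * u - s * r)) by rewrite /N; ring.
  have h : 0 <= (2 - r) * u - s * r by nra.
  by rewrite !mulr_ge0 //; lra.
have low := cut (1 + t) (- s) _ (sqrrN s).
have high := cut (1 - t) s _ erefl.
set X := A * x in Ax1 low high *; set Y := B * y in low high *.
have {}low : (1 + t) * X + - s * Y <= 1 + t + s by apply: low; lra.
have {}high : (1 - t) * X + s * Y <= 1 - t + s by apply: high; lra.
(* If [s] vanished, the two cuts would give [X <= 1]. *)
have s_gt0 : 0 < s.
  by rewrite lt_def s0 andbT; apply/eqP => sE; move: low high; rewrite sE; nra.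
(* [k] is the weight of [p]; the first coordinate determines it. *)
pose k := (X - 1) / s.
have ks : k * s = X - 1 by rewrite /k divfK // gt_eqF.
have k0 : 0 <= k by rewrite /k divr_ge0 //; lra.
have j0 : 0 <= (1 - k + (Y - k * t)) / 2.
  apply: divr_ge0 => //; rewrite -(pmulr_rge0 _ s_gt0).
  have -> : s * (1 - k + (Y - k * t)) = s - (k * s) + s * Y - (k * s) * t.
    by ring.
  rewrite ks; lra.
have i0 : 0 <= (1 - k - (Y - k * t)) / 2.
  apply: divr_ge0 => //; rewrite -(pmulr_rge0 _ s_gt0).
  have -> : s * (1 - k - (Y - k * t)) = s - (k * s) - s * Y + (k * s) * t.
    by ring.
  rewrite ks; lra.
have := convex_rel_conv3 Cconv k0 j0 i0 _ Cp Cpp Cpm.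
set i := _ / 2 in i0 *; set j := _ / 2 in j0 *.
have -> : k * (1 + s) + j * 1 + i * 1 = X.
  by rewrite mulrDr ks /i /j; field.
have -> : k * t + j * 1 + i * -1 = Y by rewrite /i /j; field.
by apply; rewrite /i /j; field.
Qed.

Lemma ellipse_sub {R : realType} {C : R -> R -> Prop}
    {s r t t' A B x y : R} (N := 2 - (s + r) + s * r) :
  convex_rel C -> (forall x y, C x y -> C (- x) (- y)) ->
  C 1 1 -> C 1 (-1) -> C (1 + s) t -> `|t| <= 1 - s ->
  C t' (1 + r) -> `|t'| <= 1 - r -> 0 <= s -> 0 <= r -> s + r <= 1 ->
  A ^+ 2 * N = 2 + s - r -> B ^+ 2 * N = 2 + r - s ->
  x ^+ 2 + y ^+ 2 <= 1 -> C (A * x) (B * y).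
Proof.
move=> Cconv Csym Cpp Cpm Cp ht Cq ht' s0 r0 sr A2 B2 xy1.
have Cmp : C (-1) 1 by have := Csym _ _ Cpm; rewrite opprK.
have neg2 (u v : R) : u ^+ 2 + v ^+ 2 <= 1 -> (- u) ^+ 2 + (- v) ^+ 2 <= 1.
  by rewrite !sqrrN.
have right u v : u ^+ 2 + v ^+ 2 <= 1 -> 1 < A * u -> C (A * u) (B * v).
  by move=> *; apply: (ellipse_cap_sub Cconv Cpp Cpm Cp ht s0 r0 sr).
have top u v : u ^+ 2 + v ^+ 2 <= 1 -> 1 < B * v -> C (A * u) (B * v).
  move=> uv1 Bv1; have Cconv' : convex_rel (fun y x => C x y).
    by move=> k ? ? ? ? hk h h'; exact: Cconv hk h h'.
  apply: (ellipse_cap_sub Cconv' Cpp Cmp Cq ht' r0 s0) => //; first lra.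
  - by rewrite -B2 /N; ring.
  - by rewrite -A2 /N; ring.
  - by rewrite addrC.
have [x1|x1] := ltP 1 (A * x); first exact: right.
have [y1|y1] := ltP 1 (B * y); first exact: top.
have [x2|x2] := ltP 1 (A * - x).
  by have := Csym _ _ (right _ _ (neg2 _ _ xy1) x2); rewrite !mulrN !opprK.
have [y2|y2] := ltP 1 (B * - y).
  by have := Csym _ _ (top _ _ (neg2 _ _ xy1) y2); rewrite !mulrN !opprK.
by move: x2 y2; rewrite !mulrN => x2 y2; apply: square_sub => //; lra.
Qed.

(** On the boundary of the octagon the quadratic form is convex along each side,
    so its maximum is at the vertices [(1 + s, 1 - s)] and [(1 - r, 1 + r)]
    (up to signs), where it takes the same value. *)
Lemma octagon_ellipse {R : realType} {s r X Y : R} :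
  0 <= s -> 0 <= r -> s + r <= 1 ->
  `|X| <= 1 + s -> `|Y| <= 1 + r -> `|X| + `|Y| <= 2 ->
  X ^+ 2 * (2 + r - s) + Y ^+ 2 * (2 + s - r) <= 4 * (1 + s * r).
Proof.
move=> s0 r0 sr.
rewrite -(real_normK (num_real X)) -(real_normK (num_real Y)).
move: (normr_ge0 X) (normr_ge0 Y); set x := `|X|; set y := `|Y|.
move=> x0 y0 xs yr xy.
have [xr|rx] := leP x (1 - r).
  have hx : x ^+ 2 <= (1 - r) ^+ 2 by rewrite ler_sqr ?nnegrE; lra.
  have hy : y ^+ 2 <= (1 + r) ^+ 2 by rewrite ler_sqr ?nnegrE; lra.
  have := ler_wpM2r (_ : 0 <= 2 + r - s) hx.
  have := ler_wpM2r (_ : 0 <= 2 + s - r) hy.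
  by move=> h1 h2; have := h1 ltac:(lra); have := h2 ltac:(lra); lra.
have hy : y ^+ 2 <= (2 - x) ^+ 2 by rewrite ler_sqr ?nnegrE; lra.
have := ler_wpM2r (_ : 0 <= 2 + s - r) hy.
move=> h; have := h ltac:(lra).
(* On the slanted side, the gap is four times this product. *)
have : 0 <= (x - (1 - r)) * (1 + s - x) by apply: mulr_ge0; lra.
lra.
Qed.

(** With [m] fixed, the difference of the two sides is a concave function of
    [s r], which runs over [[0, m^2 / 4]]; both ends are elementary. *)
Lemma ratio_bound {R : realType} {s r : R} (m := s + r) :
  0 <= s -> 0 <= r -> m <= 1 ->
  4 * (2 - m + s * r) * (1 + s * r) <=
    2 * (1 - m / 5) * ((2 + s - r) * (2 + r - s)).
Proof.
move=> s0 r0 m1.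
have -> : (2 + s - r) * (2 + r - s) = 4 - m ^+ 2 + 4 * (s * r)
  by rewrite /m; ring.
have Pm : 4 * (s * r) <= m ^+ 2.
  by have := sqr_ge0 (s - r); rewrite /m; nra.
have P0 : 0 <= s * r by nra.
have m0 : 0 <= m by rewrite /m; lra.
clearbody m; move: (s * r) Pm P0 => P Pm P0.
(* Slack at [s r = 0], then the products needed to interpolate in [s r]. *)
have h0 : 0 <= m * (3 / 5 - m / 5) by apply: mulr_ge0 => //; lra.
have : 0 <= m * P by apply: mulr_ge0.
have : 0 <= P * (m ^+ 2 - 4 * P) by apply: mulr_ge0 => //; lra.
nra.
Qed.

(** * Coordinates and Banach-Mazur positions in the plane *)

Definition det2 {R : realType} (x y : 'rV[R]_2) : R :=
  x ord0 0 * y ord0 1 - x ord0 1 * y ord0 0.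

Lemma rV2P {R : realType} (x y : 'rV[R]_2) :
  x ord0 0 = y ord0 0 -> x ord0 1 = y ord0 1 -> x = y.
Proof.
move=> h0 h1; apply/rowP => i.
by case: i => -[|[|//]] hi; [move: h0|move: h1]; congr (_ = _); congr (_ _ _);
  apply/val_inj.
Qed.

Definition row2 {R : realType} (x y : R) : 'rV[R]_2 :=
  \row_(i < 2) (if i == 0 then x else y).

Lemma row2_eta {R : realType} (z : 'rV[R]_2) : z = row2 (z ord0 0) (z ord0 1).
Proof. by apply: rV2P; rewrite mxE. Qed.

(** A diagonal map in the basis [(f1, f2)] puts [L] in position: sandwiching the
    centred [K] between the image of [L] and its dilate by [rho] bounds the
    distance. In the definition of the distance it is the larger image of [L]
    that is the linear one, hence the factors [rho * a] and [rho * b]. *)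
Lemma d_BM_le {R : realType} {K L : set 'rV[R]_2} {u f1 f2 : 'rV[R]_2}
    {a b rho : R} :
  0 < rho -> 0 < a -> 0 < b -> det2 f1 f2 != 0 ->
  (forall x y, L (row2 x y) ->
    translate K u ((a * x) *: f1 + (b * y) *: f2)) ->
  (forall z, translate K u z -> exists X Y,
    z = X *: f1 + Y *: f2 /\ L (row2 (X / (rho * a)) (Y / (rho * b)))) ->
  d_BM K L <= rho.
Proof.
move=> rho0 a0 b0 Df LK KL; apply: ge_inf; first by exists 0 => x [/ltW].
split => //.
pose e1 := (rho * a) *: f1; pose e2 := (rho * b) *: f2.
pose M : 'M[R]_2 := \matrix_(i, j) (if i == 0 then e1 else e2) ord0 j.
pose T : {linear 'rV[R]_2 -> 'rV[R]_2} := mulmxr M.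
have TE y : T y = (rho * a * y ord0 0) *: f1 + (rho * b * y ord0 1) *: f2.
  rewrite /= mulmx_sum_row big_ord_recl big_ord1.
  rewrite (_ : lift ord0 ord0 = 1); last exact/val_inj.
  by apply: rV2P; rewrite !mxE /=; ring.
have Mu : M \in unitmx.
  rewrite unitmxE unitfE (expand_det_row _ 0) big_ord_recl big_ord1 /cofactor.
  rewrite !det_mx11 !mxE /=.
  have l1 (i : 'I_1) : lift ord0 i = 1 :> 'I_2 by apply/val_inj; rewrite ord1.
  have l0 : lift 1 0 = 0 :> 'I_2 by apply/val_inj.
  rewrite !l1 l0 expr0 expr1.
  rewrite [X in X != 0](_ : _ = (rho * a) * (rho * b) * det2 f1 f2).
    by rewrite mulf_neq0 // !mulf_neq0 // gt_eqF.
  by rewrite /det2; ring.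
exists T, u, 0; split.
- by exists (mulmxr (invmx M)) => x /=; rewrite ?mulmxK ?mulmxKV.
- move=> z /KL[X [Y [-> LXY]]].
  exists (row2 (X / (rho * a)) (Y / (rho * b)) + 0).
    by exists (row2 (X / (rho * a)) (Y / (rho * b))).
  rewrite addr0 TE !mxE /= ![rho * _ * _]mulrC.
  by rewrite !divfK // gt_eqF // mulr_gt0.
- move=> _ [_ [y Ly <-] <-]; rewrite addr0 TE.
  exists ((a * y ord0 0) *: f1 + (b * y ord0 1) *: f2).
    by apply: LK; rewrite -row2_eta.
  by rewrite scalerDr !scalerA !mulrA.
Qed.

Lemma det2_coords {R : realType} {u v : 'rV[R]_2} (x : 'rV[R]_2) :
  det2 u v != 0 -> x = (det2 x v / det2 u v) *: u + (det2 u x / det2 u v) *: v.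
Proof.
rewrite /det2 => D0; apply: rV2P; rewrite !mxE; field; exact: D0.
Qed.

Lemma det2_continuous {R : realType} (a : 'rV[R]_2) : continuous (det2^~ a).
Proof.
move=> x.
have c (i : 'I_2) : (fun y : 'rV[R]_2 => y ord0 i) @ x --> x ord0 i.
  exact: coord_continuous.
exact: (cvgB (cvgM (c 0) (cvg_cst _)) (cvgM (c 1) (cvg_cst _))).
Qed.

(** * The inscribed parallelogram of maximal area *)

Lemma exists_max_det2 {R : realType} {A : set 'rV[R]_2} :
  compact A -> A !=set0 -> exists u v, [/\ A u, A v &
    forall x y, A x -> A y -> det2 x y <= det2 u v].
Proof.
move=> cA A0.
have AA0 : (A `*` A) !=set0 by case: A0 => a Aa; exists (a, a).
have cont : {within A `*` A, continuous (fun z => det2 z.1 z.2)}.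
  apply: continuous_subspaceT => z.
  have c1 (i : 'I_2) :
      (fun z : 'rV[R]_2 * 'rV[R]_2 => z.1 ord0 i) @ z --> z.1 ord0 i.
    apply: (@cvg_comp _ _ _ fst (fun x : 'rV[R]_2 => x ord0 i)
      (nbhs z) (nbhs z.1)).
      exact: cvg_fst.
    exact: (@coord_continuous R 1 2 ord0 i _).
  have c2 (i : 'I_2) :
      (fun z : 'rV[R]_2 * 'rV[R]_2 => z.2 ord0 i) @ z --> z.2 ord0 i.
    apply: (@cvg_comp _ _ _ snd (fun x : 'rV[R]_2 => x ord0 i)
      (nbhs z) (nbhs z.2)).
      exact: cvg_snd.
    exact: (@coord_continuous R 1 2 ord0 i _).
  exact: (cvgB (cvgM (c1 0) (c2 1)) (cvgM (c1 1) (c2 0))).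
have [[u v] /set_mem[/= Au Av] max] :=
  compact_EVT_max AA0 (compact_setX cA cA) cont.
by exists u, v; split => // x y Ax Ay; apply: (max (x, y)); rewrite inE.
Qed.

Lemma convex_setP {R : realType} {K : set 'rV[R]_2} {x y : 'rV[R]_2} {k : R} :
  convex_set (K : set (convex_lmodType 'rV[R]_2)) -> 0 <= k <= 1 ->
  K x -> K y -> K (k *: x + (1 - k) *: y).
Proof.
move=> cK k01 /mem_set Kx /mem_set Ky.
case/andP: k01 => k0 k1; exact/set_mem/(cK _ _ (Itv01 k0 k1) Kx Ky).
Qed.

(** Moving an interior point along both axes gives three points of the body; if
    all their pairwise determinants vanished, the square of the step would. *)
Lemma interior_det2 {R : realType} {K : set 'rV[R]_2} (w : 'rV[R]_2) :
  K° !=set0 ->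
  exists x y, [/\ translate K w x, translate K w y & det2 x y != 0].
Proof.
move=> [a /nbhs_ballP[e /= e0 Ke]].
pose p i : 'rV[R]_2 := a + (e / 2) *: delta_mx ord0 i + w.
have Kp i : translate K w (p i).
  exists (a + (e / 2) *: delta_mx ord0 i) => //; apply: Ke.
  split=> // i' j; rewrite -ball_normE /ball_ /= !mxE opprD addNKr normrN.
  by rewrite ger0_norm; case: (_ && _); rewrite ?mulr1 ?mulr0; lra.
have Ka : translate K w (a + w) by exists a => //; apply/Ke/ballxx.
have e2 : e / 2 != 0 by rewrite gt_eqF // divr_gt0.
have [h1|h1] := eqVneq (det2 (a + w) (p 0)) 0; last by exists (a + w), (p 0).
have [h2|h2] := eqVneq (det2 (a + w) (p 1)) 0; last by exists (a + w), (p 1).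
exists (p 0), (p 1); split => //; apply/eqP => h3.
move: h1 h2 h3; rewrite /det2 /p !mxE /= => h1 h2 h3.
have : 0 < e * e by rewrite mulr_gt0.
lra.
Qed.

Lemma det2_comb {R : realType} (f1 f2 : 'rV[R]_2) (a b c d : R) :
  det2 (a *: f1 + b *: f2) (c *: f1 + d *: f2) = (a * d - b * c) * det2 f1 f2.
Proof. by rewrite /det2 !mxE; ring. Qed.

Lemma det2_max_coord {R : realType} {A : set 'rV[R]_2} (f : 'rV[R]_2) :
  compact A -> A !=set0 ->
  exists2 p, A p & forall x, A x -> det2 x f <= det2 p f.
Proof.
move=> cA A0.
have [p /set_mem Ap max] := compact_EVT_max A0 cA
  (continuous_subspaceT (det2_continuous f)).
by exists p => // x Ax; apply: max; rewrite inE.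
Qed.

(** [f1 + f2] and [f1 - f2] are adjacent vertices of the inscribed
    parallelogram, and [s], [r] measure how far [A] sticks out of it beyond its
    two pairs of sides. *)
Definition adapted {R : realType} (A : set 'rV[R]_2) (f1 f2 : 'rV[R]_2)
    (s r : R) : Prop :=
  let C X Y := A (X *: f1 + Y *: f2) in
  [/\ det2 f1 f2 != 0,
      [/\ 0 <= s, 0 <= r & s + r <= 1],
      C 1 1 /\ C 1 (-1),
      (exists2 t, `|t| <= 1 - s & C (1 + s) t) /\
      (exists2 t, `|t| <= 1 - r & C t (1 + r)) &
      forall z, A z -> exists X Y, [/\ z = X *: f1 + Y *: f2,
        `|X| <= 1 + s, `|Y| <= 1 + r & `|X| + `|Y| <= 2]].

(** The vertices [u], [v] maximize the determinant on [A]. In coordinates,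
    comparing [det2 u v] with [det2 x v] and [det2 u x] gives [|X| + |Y| <= 2],
    and comparing it with [det2 p q] for points [p], [q] maximizing [X] and [Y]
    gives [(1 + s) (1 + r) <= 2 + (1 - s) (1 - r)], i.e. [s + r <= 1]. *)
Lemma exists_adapted {R : realType} {A : set 'rV[R]_2} :
  compact A -> (forall x, A x -> A (- x)) ->
  (exists x y, [/\ A x, A y & det2 x y != 0]) ->
  exists f1 f2 s r, adapted A f1 f2 s r.
Proof.
move=> cA symA [x0 [y0 [Ax0 Ay0 D0]]].
have A0 : A !=set0 by exists x0.
have [u [v [Au Av max]]] := exists_max_det2 cA A0.
have Dpos : 0 < det2 u v.
  have [hn|hp|h0] := ltgtP (det2 x0 y0) 0; last by rewrite h0 eqxx in D0.
  - apply: (lt_le_trans _ (max _ _ Ay0 Ax0)); move: hn; rewrite /det2; lra.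
  - exact: (lt_le_trans hp (max _ _ Ax0 Ay0)).
pose f1 := 2^-1 *: (u - v); pose f2 := 2^-1 *: (u + v).
have uE : u = 1 *: f1 + 1 *: f2 by apply: rV2P; rewrite !mxE; field.
have vE : - v = 1 *: f1 + (-1) *: f2 by apply: rV2P; rewrite !mxE; field.
have Df : det2 f1 f2 = det2 u v / 2 by rewrite /det2 !mxE; field.
have Df0 : det2 f1 f2 != 0 by rewrite Df gt_eqF // divr_gt0.
pose X z := det2 z f2 / det2 f1 f2; pose Y z := det2 z (- f1) / det2 f1 f2.
have XY z : z = X z *: f1 + Y z *: f2.
  rewrite {1}(det2_coords z Df0) /X /Y; congr (_ + (_ / _) *: _).
  by rewrite /det2 !mxE; ring.
have D2 : 0 < det2 f1 f2 by rewrite Df divr_gt0.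
have XN z : X (- z) = - X z.
  by rewrite /X -mulNr; congr (_ / _); rewrite /det2 !mxE; ring.
have YN z : Y (- z) = - Y z.
  by rewrite /Y -mulNr; congr (_ / _); rewrite /det2 !mxE; ring.
have hex z : A z -> `|X z| + `|Y z| <= 2.
  move=> Az.
  have hv a : A a -> X a + Y a <= 2.
    move=> Aa; have := max _ _ Aa Av.
    have {1}-> : v = (-1) *: f1 + 1 *: f2.
      by rewrite -[v]opprK vE; apply: rV2P; rewrite !mxE; ring.
    rewrite {1}[a]XY det2_comb Df => h; rewrite -(ler_pM2r Dpos); lra.
  have hu a : A a -> Y a - X a <= 2.
    move=> Aa; have := max _ _ Au Aa.
    rewrite {1}uE {1}[a]XY det2_comb Df => h; rewrite -(ler_pM2r Dpos); lra.
  have := hv _ Az; have := hu _ Az; have := hv _ (symA _ Az).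
  have := hu _ (symA _ Az); rewrite XN YN.
  by case: (ler0P (X z)); case: (ler0P (Y z)); lra.
have [p Ap maxX] := det2_max_coord f2 cA A0.
have [q Aq maxY] := det2_max_coord (- f1) cA A0.
have Xle z : A z -> X z <= X p by move=> Az; rewrite ler_pM2r ?invr_gt0 // maxX.
have Yle z : A z -> Y z <= Y q by move=> Az; rewrite ler_pM2r ?invr_gt0 // maxY.
have Xu : X u = 1.
  rewrite /X {1}uE [det2 _ f2](_ : _ = det2 f1 f2) ?divff //.
  by rewrite /det2 !mxE; ring.
have Yu : Y u = 1.
  rewrite /Y {1}uE [det2 _ (- f1)](_ : _ = det2 f1 f2) ?divff //.
  by rewrite /det2 !mxE; ring.
have s0 : 1 <= X p by rewrite -Xu Xle.
have r0 : 1 <= Y q by rewrite -Yu Yle.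
have := hex p Ap; have := hex q Aq.
rewrite (@ger0_norm _ (X p)) ?(@ger0_norm _ (Y q)); try lra.
move=> hq hp.
exists f1, f2, (X p - 1), (Y q - 1).
have addK a : 1 + (a - 1) = a :> R by rewrite addrC subrK.
rewrite /adapted /= !addK -uE -vE; split=> //.
- split; try lra.
  have := max _ _ Ap Aq.
  rewrite {1}[p]XY {1}[q]XY det2_comb Df => h.
  have {}h : X p * Y q - Y p * X q <= 2 by rewrite -(ler_pM2r Dpos); lra.
  have : Y p * X q <= (2 - X p) * (2 - Y q).
    apply: (le_trans (ler_norm _)); rewrite normrM ler_pM //; lra.
  nra.
- by split=> //; exact: symA.
- split; first by exists (Y p); rewrite -?XY //; lra.
  by exists (X q); rewrite -?XY //; lra.
- move=> z Az; exists (X z), (Y z); split=> //; last exact: hex.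
  + by rewrite ler_norml Xle // andbT lerNl -XN Xle //; exact: symA.
  + by rewrite ler_norml Yle // andbT lerNl -YN Yle //; exact: symA.
Qed.

(** * Distances to the square and to the disc *)

Lemma euclidean_ball_row2 {R : realType} (x y : R) :
  euclidean_ball (row2 x y) <-> x ^+ 2 + y ^+ 2 <= 1.
Proof.
rewrite /euclidean_ball /= /enorm big_ord_recl big_ord1 !mxE /=.
by rewrite -{1}sqrtr1 ler_sqrt.
Qed.

Lemma cube_row2 {R : realType} (x y : R) :
  cube (row2 x y) <-> `|x| <= 1 /\ `|y| <= 1.
Proof.
rewrite /cube /= !ler_norml; split => [h|[hx hy] i].
  by have := h 0; have := h 1; rewrite !mxE !in_itv.
by rewrite mxE in_itv /=; case: (i == 0).
Qed.

Lemma d_BM_cube_le {R : realType} {K : set 'rV[R]_2} {w f1 f2 : 'rV[R]_2}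
    {s r : R} (C := fun X Y => translate K w (X *: f1 + Y *: f2)) :
  convex_rel C -> (forall X Y, C X Y -> C (- X) (- Y)) ->
  adapted (translate K w) f1 f2 s r -> d_BM K (@cube R 2) <= 1 + (s + r).
Proof.
move=> Cconv Csym [Df [s0 r0 sr] [Cpp Cpm] _ hull].
have m0 : 0 < 1 + (s + r) by lra.
have s1 : 0 < 1 + s by lra.
have r1 : 0 < 1 + r by lra.
apply: (d_BM_le (a := (1 + s) / (1 + (s + r)))
  (b := (1 + r) / (1 + (s + r))) m0 _ _ Df); rewrite ?divr_gt0 //.
  move=> x y /cube_row2; rewrite !ler_norml => -[hx hy].
  (* Scaled down by [1 + (s + r)], the outer rectangle fits in the square. *)
  have shrink (c z : R) : 0 <= c <= 1 + (s + r) -> -1 <= z <= 1 ->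
      -1 <= c / (1 + (s + r)) * z <= 1.
    move=> /andP[c0 c1] hz.
    have k0 : 0 <= c / (1 + (s + r)) by rewrite divr_ge0 // ltW.
    have k1 : c / (1 + (s + r)) <= 1 by rewrite ler_pdivrMr // mul1r.
    by apply/andP; split; nra.
  by apply: (square_sub Cconv Csym Cpp Cpm); apply: shrink => //; lra.
move=> z /hull[X [Y [-> hX hY _]]]; exists X, Y; split=> //.
rewrite ![(1 + (s + r)) * _]mulrC !divfK ?gt_eqF //.
apply/cube_row2; rewrite !normf_div (gtr0_norm s1) (gtr0_norm r1).
by rewrite !ler_pdivrMr // !mul1r.
Qed.

Lemma d_BM_ball_le {R : realType} {K : set 'rV[R]_2} {w f1 f2 : 'rV[R]_2}
    {s r : R} (C := fun X Y => translate K w (X *: f1 + Y *: f2)) :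
  convex_rel C -> (forall X Y, C X Y -> C (- X) (- Y)) ->
  adapted (translate K w) f1 f2 s r ->
  d_BM K (@euclidean_ball R 2) <= Num.sqrt (2 * (1 - (s + r) / 5)).
Proof.
move=> Cconv Csym [Df [s0 r0 sr] [Cpp Cpm] [[t ht Cp] [t' ht' Cq]] hull].
pose N := 2 - (s + r) + s * r.
have P0 : 0 <= s * r by rewrite mulr_ge0.
have N0 : 0 < N by rewrite /N; lra.
have sr0 : 0 < 2 + s - r by lra.
have rs0 : 0 < 2 + r - s by lra.
have rho2 : 0 < 2 * (1 - (s + r) / 5) by lra.
pose A := Num.sqrt ((2 + s - r) / N); pose B := Num.sqrt ((2 + r - s) / N).
have A0 : 0 < A by rewrite sqrtr_gt0 divr_gt0.
have B0 : 0 < B by rewrite sqrtr_gt0 divr_gt0.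
have AE : A ^+ 2 = (2 + s - r) / N by rewrite sqr_sqrtr // ltW // divr_gt0.
have A2 : A ^+ 2 * N = 2 + s - r by rewrite AE divfK // gt_eqF.
have BE : B ^+ 2 = (2 + r - s) / N by rewrite sqr_sqrtr // ltW // divr_gt0.
have B2 : B ^+ 2 * N = 2 + r - s by rewrite BE divfK // gt_eqF.
apply: (d_BM_le (a := A) (b := B) _ A0 B0 Df); first by rewrite sqrtr_gt0.
  move=> x y /euclidean_ball_row2 xy1.
  exact: (ellipse_sub Cconv Csym Cpp Cpm Cp ht Cq ht' s0 r0 sr).
move=> z /hull[X [Y [-> hX hY hXY]]]; exists X, Y; split=> //.
apply/euclidean_ball_row2.
have oct := octagon_ellipse s0 r0 sr hX hY hXY.
have bound := ratio_bound s0 r0 sr.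
rewrite !expr_div_n !exprMn (sqr_sqrtr (ltW rho2)).
move: (2 * _) rho2 bound => q q0 bound; rewrite AE BE.
have -> : X ^+ 2 / (q * ((2 + s - r) / N)) + Y ^+ 2 / (q * ((2 + r - s) / N)) =
    N * (X ^+ 2 * (2 + r - s) + Y ^+ 2 * (2 + s - r)) /
    (q * ((2 + s - r) * (2 + r - s))).
  by field; rewrite !gt_eqF.
rewrite ler_pdivrMr ?mul1r; last by rewrite !mulr_gt0.
have := ler_wpM2l (ltW N0) oct; rewrite /N in bound *; lra.
Qed.

Theorem theorem1p3 (R : realType) (K : set 'rV[R]_2) (eps : R)
    (hK : convex_body K) (hsym : symmetric_body K) (heps : 0 < eps)
    (hd : Num.sqrt 2 - eps <= d_BM K (@euclidean_ball R 2)) :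
  d_BM K (@cube R 2) < 1 + 5 * Num.sqrt 2 * eps.
Proof.
case: hK => cK convK intK; case: hsym => w symK.
have symA z : translate K w z -> translate K w (- z).
  by move=> Az; rewrite -symK; exists z.
have cA : compact (translate K w).
  apply: continuous_compact => //; apply: continuous_subspaceT => x.
  exact: (cvgD cvg_id (cvg_cst _)).
have [f1 [f2 [s [r adp]]]] := exists_adapted cA symA (interior_det2 w intK).
pose C X Y := translate K w (X *: f1 + Y *: f2).
have Cconv : convex_rel C.
  move=> k x y x' y' k01 [a Ka ha] [b Kb hb].
  exists (k *: a + (1 - k) *: b); first exact: convex_setP.
  move: ha hb => /(canRL (addrK _)) -> /(canRL (addrK _)) ->.
  by apply: rV2P; rewrite !mxE; ring.
have Csym X Y : C X Y -> C (- X) (- Y).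
  by move=> /symA; rewrite /C opprD !scaleNr.
apply: (le_lt_trans (d_BM_cube_le Cconv Csym adp)).
have := d_BM_ball_le Cconv Csym adp.
have [_ [s0 r0 sr] _ _ _] := adp.
have m0 : 0 <= s + r by rewrite addr_ge0.
move: (s + r) m0 sr => m m0 m1 /(le_trans hd) hm.
rewrite ltrD2l ltNge; apply/negP => epsm.
set q := Num.sqrt 2 in hd hm epsm.
have q0 : 0 < q by rewrite sqrtr_gt0.
have q2 : q * q = 2 by rewrite -expr2 sqr_sqrtr.
(* If [5 sqrt 2 eps <= m], the bound for the disc is at least
   [sqrt 2 (1 - m / 10)]; squaring leaves [m^2 <= 0], so [eps <= 0]. *)
have eps_le : eps <= q * (m / 10).
  by rewrite -(ler_pM2l q0) mulrA q2; lra.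
have : q * (1 - m / 10) <= Num.sqrt (2 * (1 - m / 5)) by lra.
rewrite -ler_sqr ?nnegrE ?sqrtr_ge0 //; last by rewrite mulr_ge0 ?ltW //; lra.
rewrite sqr_sqrtr ?exprMn ?[q ^+ 2]expr2 ?q2 => [h|]; last by lra.
have mE : m = 0 by apply/eqP; rewrite -sqrf_eq0 eq_le sqr_ge0 andbT; lra.
by move: eps_le; rewrite mE; lra.
Qed.
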